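(* Let $0<\mathrm{Ste}<1$, $\alpha\ge 0$ and $\mathrm{Bi}>0$. Then there exists a unique solution to problem $(\mathrm{P}_{3h})$, which is given by $$T_{3h}(x,t)=t^{\alpha/2}\left[A_{3h}\theta_\infty\left(1-\frac{x}{s_{3h}(t)}\right)+B_{3h}\theta_\infty\left(1-\frac{x}{s_{3h}(t)}\right)^2\right],\qquad s_{3h}(t)=2a\nu_{3h}\sqrt{t},$$ where the constants $A_{3h}$ and $B_{3h}$ are defined by $$A_{3h}=\frac{12\nu_{3h}\left(1-\nu_{3h}^2\left(\frac{\alpha}{2}+\frac13\right)\right)}{2\alpha\nu_{3h}^3+\left(\frac{5\alpha+2}{\mathrm{Bi}}\right)\nu_{3h}^2+\frac{6}{\mathrm{Bi}}+12\nu_{3h}},\qquad B_{3h}=\frac{12\nu_{3h}^3\left(\frac23\alpha+\frac13\right)}{2\alpha\nu_{3h}^3+\left(\frac{5\alpha+2}{\mathrm{Bi}}\right)\nu_{3h}^2+\frac{6}{\mathrm{Bi}}+12\nu_{3h}},$$ and where $\nu_{3h}$ is the unique solution to the equation $$2^{\alpha+1}\alpha z^{\alpha+4}+\frac{2^{\alpha}(2+5\alpha)}{\mathrm{Bi}}z^{\alpha+3}+3\cdot 2^{\alpha+2}z^{\alpha+2}+\frac{3\cdot 2^{\alpha+1}}{\mathrm{Bi}}z^{\alpha+1}+\mathrm{Ste}(2+3\alpha)z^2-6\,\mathrm{Ste}=0,\qquad z>0.$$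
   Context: Fix real parameters $k,\rho,c,\gamma,\theta_\infty,h>0$ and $\alpha\ge 0$; put $a=\sqrt{k/(\rho c)}$, and define the generalized Stefan number $\mathrm{Ste}=\dfrac{k\theta_\infty}{\gamma a^{\alpha+2}}$ and the Biot number $\mathrm{Bi}=\dfrac{ah}{k}$. A candidate pair $(T,s)$ consists of a continuous function $s:[0,\infty)\to[0,\infty)$, positive and continuously differentiable on $(0,\infty)$, and a function with quadratic profile in space $$T(x,t)=t^{\alpha/2}\theta_\infty\left[A\left(1-\frac{x}{s(t)}\right)+B\left(1-\frac{x}{s(t)}\right)^2\right],\quad 0\le x\le s(t),\ t>0,$$ with real constants $A,B$. Problem $(\mathrm{P}_{3h})$ (refined integral method, Robin condition): find a candidate pair $(T,s)=(T_{3h},s_{3h})$ such that, for all $t>0$: (i) $\displaystyle\int_0^{s(t)}\int_0^x\dfrac{\partial T}{\partial t}(z,t)\,dz\,dx=-a^2\left[T(0,t)+\dfrac{\partial T}{\partial x}(0,t)\,s(t)\right]$; (ii) $k\dfrac{\partial T}{\partial x}(0,t)=\dfrac{h}{\sqrt t}\left[T(0,t)-\theta_\infty t^{\alpha/2}\right]$; (iii) $T(s(t),t)=0$; (iv) $k\dfrac{\partial T}{\partial x}(s(t),t)=-\gamma s(t)^{\alpha}\dot s(t)$; and (v) $s(0)=0$. Uniqueness is meant among candidate pairs. *)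

(* Defs.v *)
From Stdlib Require Import Reals.
From Coquelicot Require Import Coquelicot.
Open Scope R_scope.

Definition thermal_a (k rho c : R) : R := sqrt (k / (rho * c)).

Definition Ste_number (k rho c gamma theta alpha : R) : R :=
  k * theta / (gamma * Rpower (thermal_a k rho c) (alpha + 2)).

Definition Bi_number (k rho c h : R) : R := thermal_a k rho c * h / k.

Definition quad_profile (theta alpha A B : R) (s : R -> R) (x t : R) : R :=
  Rpower t (alpha / 2) * theta
    * (A * (1 - x / s t) + B * (1 - x / s t) ^ 2).

(* [s] only matters on [0, oo) and [T] only on {(x, t) | 0 <= x <= s t, 0 < t};
   the values of these total functions elsewhere are unconstrained. *)
Definition candidate (theta alpha : R) (T : R -> R -> R) (s : R -> R) : Prop :=
  continuous_on (fun t => 0 <= t) s /\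
  (forall t, 0 <= t -> 0 <= s t) /\
  (forall t, 0 < t -> 0 < s t) /\
  (forall t, 0 < t -> ex_derive s t /\ continuous (Derive s) t) /\
  exists A B : R, forall t x, 0 < t -> 0 <= x <= s t ->
    T x t = quad_profile theta alpha A B s x t.

(* [is_derive] with the neighbourhood filter restricted to [D]: at an endpoint
   of an interval [D] this is the one-sided derivative. *)
Definition is_derive_within (D : R -> Prop) (f : R -> R) (x l : R) : Prop :=
  filterdiff f (within D (locally x)) (fun y => scal y l).

(* [Tx0] and [Txs] are the spatial derivatives of [T] at the two ends of
   [0, s t], taken from inside the interval. In the double integral the time
   derivative is only used for 0 < z < s t, where the continuity of [s] makes
   [T z] determined by the profile near [t]; so, for a candidate, it and both
   integrals exist and do not depend on values of [T] outside the domain. *)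
Definition problem_P3h (k rho c gamma theta h alpha : R)
    (T : R -> R -> R) (s : R -> R) : Prop :=
  candidate theta alpha T s /\
  (forall t, 0 < t -> exists Tx0 Txs : R,
     is_derive_within (fun x => 0 <= x <= s t) (fun x => T x t) 0 Tx0 /\
     is_derive_within (fun x => 0 <= x <= s t) (fun x => T x t) (s t) Txs /\
     RInt (fun x => RInt (fun z => Derive (fun tau => T z tau) t) 0 x) 0 (s t)
       = - (thermal_a k rho c) ^ 2 * (T 0 t + Tx0 * s t) /\
     k * Tx0 = h / sqrt t * (T 0 t - theta * Rpower t (alpha / 2)) /\
     T (s t) t = 0 /\
     k * Txs = - gamma * Rpower (s t) alpha * Derive s t) /\
  s 0 = 0.

Definition same_pair (T1 : R -> R -> R) (s1 : R -> R)
    (T2 : R -> R -> R) (s2 : R -> R) : Prop :=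
  (forall t, 0 <= t -> s1 t = s2 t) /\
  (forall t x, 0 < t -> 0 <= x <= s1 t -> T1 x t = T2 x t).

Definition denom3h (alpha Bi nu : R) : R :=
  2 * alpha * nu ^ 3 + (5 * alpha + 2) / Bi * nu ^ 2 + 6 / Bi + 12 * nu.

Definition A3h (alpha Bi nu : R) : R :=
  12 * nu * (1 - nu ^ 2 * (alpha / 2 + 1 / 3)) / denom3h alpha Bi nu.

Definition B3h (alpha Bi nu : R) : R :=
  12 * nu ^ 3 * (2 / 3 * alpha + 1 / 3) / denom3h alpha Bi nu.

Definition s3h (a nu t : R) : R := 2 * a * nu * sqrt t.

Definition T3h (theta alpha a Bi nu x t : R) : R :=
  Rpower t (alpha / 2)
    * (A3h alpha Bi nu * theta * (1 - x / s3h a nu t)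
       + B3h alpha Bi nu * theta * (1 - x / s3h a nu t) ^ 2).

Definition nu3h_equation (alpha Ste Bi z : R) : Prop :=
  Rpower 2 (alpha + 1) * alpha * Rpower z (alpha + 4)
  + Rpower 2 alpha * (2 + 5 * alpha) / Bi * Rpower z (alpha + 3)
  + 3 * Rpower 2 (alpha + 2) * Rpower z (alpha + 2)
  + 3 * Rpower 2 (alpha + 1) / Bi * Rpower z (alpha + 1)
  + Ste * (2 + 3 * alpha) * z ^ 2 - 6 * Ste = 0.

(* Main.v *)
(** A quadratic profile turns each of the conditions at time [t] into an
    algebraic relation between [t], [s t], [Derive s t] and the coefficients
    [A], [B].  If [A + B <> 1] the Robin condition forces [s t] to be a
    constant multiple of [sqrt t]; if [A + B = 1] it forces [A = 2], [B = -1],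
    and then the integral condition equates a positive and a negative quantity.
    For [s t = 2 * a * nu * sqrt t] time cancels out: the integral and Robin
    conditions become a nonsingular linear system whose solution is
    [A3h nu], [B3h nu], and the Stefan condition becomes the equation for [nu],
    an increasing function of [nu] being equal to a decreasing one. *)

Require Import Defs.
From Stdlib Require Import Reals Ranalysis5 Lra.
From Coquelicot Require Import Coquelicot.
Open Scope R_scope.

(** * Derivatives within a set and iterated integrals of quadratics *)

Lemma Rpower_pos (x y : R) : 0 < Rpower x y.
Proof. apply exp_pos. Qed.

(** The filter restricted to [D] sees only values on [D], so [T] inherits its one-sided derivatives
    from the smooth profile. [D x] makes that filter proper, hence its limit point is [x] alone. *)
Lemma is_derive_within_of_is_derive (D : R -> Prop) (f g : R -> R) (x l : R) :
  D x -> (forall y, D y -> f y = g y) -> is_derive f x l ->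
  is_derive_within D g x l.
Proof.
intros Dx efg df.
assert (PF : ProperFilter (within D (locally x))).
{ split; [|apply within_filter; apply locally_filter].
  intros P HP; exists x; exact (locally_singleton x _ HP Dx). }
assert (lim : is_filter_lim (within D (locally x)) x).
{ intros P HP; exact (filter_le_within D P HP). }
apply (filterdiff_ext_loc f).
- exists (mkposreal 1 Rlt_0_1); intros y _ Dy; exact (efg y Dy).
- intros y Hy; apply efg.
  replace y with x; [exact Dx|].
  apply (is_filter_lim_unique (F := within D (locally x))); assumption.
- apply (filterdiff_locally f x); [exact lim|exact df].
Qed.

(** At an isolated point of [D] every number would be a derivative, whence the accumulation
    hypothesis. With tolerance [Rabs (l1 - l2) / 4] for both linear approximations, the two errors
    add up to at most half of [Rabs (l1 - l2) * Rabs (y - x)], against the triangle inequality. *)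
Lemma is_derive_within_unique (D : R -> Prop) (f : R -> R) (x l1 l2 : R) :
  (forall e : posreal, exists y, D y /\ y <> x /\ Rabs (y - x) < e) ->
  is_derive_within D f x l1 -> is_derive_within D f x l2 -> l1 = l2.
Proof.
intros acc [_ d1] [_ d2].
assert (lim : is_filter_lim (within D (locally x)) x).
{ intros P HP; exact (filter_le_within D P HP). }
destruct (Req_dec l1 l2) as [e12|ne]; [exact e12|exfalso].
assert (pos : 0 < Rabs (l1 - l2)) by (apply Rabs_pos_lt; lra).
assert (pos4 : 0 < Rabs (l1 - l2) / 4) by lra.
destruct (filter_and _ _ (d1 x lim (mkposreal _ pos4))
            (d2 x lim (mkposreal _ pos4))) as [e He].
destruct (acc e) as (y & Dy & nyx & ley).
destruct (He y ley Dy) as [H1 H2].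
change (Rabs (f y - f x - (y - x) * l1) <= Rabs (l1 - l2) / 4 * Rabs (y - x)) in H1.
change (Rabs (f y - f x - (y - x) * l2) <= Rabs (l1 - l2) / 4 * Rabs (y - x)) in H2.
assert (posyx : 0 < Rabs (y - x)) by (apply Rabs_pos_lt; lra).
assert (tri : Rabs (l1 - l2) * Rabs (y - x)
              <= Rabs (f y - f x - (y - x) * l1) + Rabs (f y - f x - (y - x) * l2)).
{ rewrite <- Rabs_mult, (Rabs_minus_sym (f y - f x)).
  eapply Rle_trans; [|apply Rabs_triang].
  apply Req_le; f_equal; ring. }
pose proof (Rmult_lt_0_compat _ _ pos posyx); lra.
Qed.

(** Integrals ignore the endpoints, so [f] is prescribed only inside the interval: at the moving end
    [z = s t] the time derivative of [T] may depend on values outside the domain. *)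
Lemma RInt_RInt_quadratic (f : R -> R) (b c0 c1 c2 : R) :
  0 < b -> (forall z, 0 < z < b -> f z = c0 + c1 * z + c2 * z ^ 2) ->
  RInt (fun x => RInt f 0 x) 0 b
  = c0 * b ^ 2 / 2 + c1 * b ^ 3 / 6 + c2 * b ^ 4 / 12.
Proof.
intros b0 Ef.
transitivity (RInt (fun x => c0 * x + c1 * x ^ 2 / 2 + c2 * x ^ 3 / 3) 0 b).
- apply RInt_ext; intros x; rewrite Rmin_left, Rmax_right by lra; intros Hx.
  transitivity (RInt (fun z => c0 + c1 * z + c2 * z ^ 2) 0 x).
  + apply RInt_ext; intros z; rewrite Rmin_left, Rmax_right by lra; intros Hz.
    apply Ef; lra.
  + apply is_RInt_unique.
    replace (c0 * x + c1 * x ^ 2 / 2 + c2 * x ^ 3 / 3)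
      with (minus ((fun x => c0 * x + c1 * x ^ 2 / 2 + c2 * x ^ 3 / 3) x)
                  ((fun x => c0 * x + c1 * x ^ 2 / 2 + c2 * x ^ 3 / 3) 0))
      by (unfold minus, plus, opp; simpl; field).
    apply (is_RInt_derive (fun x => c0 * x + c1 * x ^ 2 / 2 + c2 * x ^ 3 / 3)
             (fun z => c0 + c1 * z + c2 * z ^ 2)).
    * intros z _; auto_derive; [easy|field].
    * intros z _; apply (@ex_derive_continuous R_AbsRing R_NormedModule).
      auto_derive; easy.
- apply is_RInt_unique.
  replace (c0 * b ^ 2 / 2 + c1 * b ^ 3 / 6 + c2 * b ^ 4 / 12)
    with (minus ((fun x => c0 * x ^ 2 / 2 + c1 * x ^ 3 / 6 + c2 * x ^ 4 / 12) b)
                ((fun x => c0 * x ^ 2 / 2 + c1 * x ^ 3 / 6 + c2 * x ^ 4 / 12) 0))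
    by (unfold minus, plus, opp; simpl; field).
  apply (is_RInt_derive (fun x => c0 * x ^ 2 / 2 + c1 * x ^ 3 / 6 + c2 * x ^ 4 / 12)
           (fun x => c0 * x + c1 * x ^ 2 / 2 + c2 * x ^ 3 / 3)).
  + intros z _; auto_derive; [easy|field].
  + intros z _; apply (@ex_derive_continuous R_AbsRing R_NormedModule).
    auto_derive; easy.
Qed.

(** * Derivatives of the profile and reduction to algebraic relations *)

Lemma is_derive_quad_profile_space (theta alpha A B : R) (s : R -> R) (x t : R) :
  0 < s t ->
  is_derive (fun x => quad_profile theta alpha A B s x t) x
    (- Rpower t (alpha / 2) * theta * (A + 2 * B * (1 - x / s t)) / s t).
Proof.
intros st; unfold quad_profile.
auto_derive; [easy|field; lra].
Qed.

Lemma is_derive_quad_profile_time (theta alpha A B : R) (s : R -> R) (z t : R) :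
  0 < t -> 0 < s t -> ex_derive s t ->
  is_derive (fun tau => quad_profile theta alpha A B s z tau) t
    (theta * Rpower t (alpha / 2)
     * (alpha / (2 * t) * (A * (1 - z / s t) + B * (1 - z / s t) ^ 2)
        + Derive s t / s t * (A + 2 * B * (1 - z / s t)) * (z / s t))).
Proof.
intros t0 st ds; unfold quad_profile, Rpower.
auto_derive; [repeat split; try assumption; lra|].
fold (Rpower t (alpha / 2)); change (Derive (fun x => s x) t) with (Derive s t).
field; lra.
Qed.

(* The integral, Robin and Stefan conditions for a quadratic profile, the first
   two divided by [theta * Rpower t (alpha / 2)]; [c2], [st], [dst] stand for
   a^2, s(t), s'(t). *)
Definition profile_system (k c2 gamma theta h alpha A B t st dst : R) : Prop :=
  alpha / (2 * t) * st ^ 2 * (A / 3 + B / 4) + st * dst * (A + B) / 6 = c2 * B /\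
  k * (A + 2 * B) * sqrt t = h * st * (1 - A - B) /\
  k * theta * Rpower t (alpha / 2) * A = gamma * Rpower st alpha * dst * st.

(** The one-sided derivatives exist by the profile and are unique, so [Tx0] and [Txs] are known in
    both directions. In the integral condition, [T 0 t + Tx0 * s t] collapses to a multiple of
    [- B]. The Stefan condition is multiplied by [- s t], and [T (s t) t = 0] holds for every
    profile. *)
Lemma problem_iff_profile_system (k rho c gamma theta h alpha A B : R)
    (T : R -> R -> R) (s : R -> R) (t : R) :
  0 < theta -> 0 < t ->
  (forall tau, 0 < tau -> 0 < s tau) -> ex_derive s t ->
  (forall tau x, 0 < tau -> 0 <= x <= s tau ->
     T x tau = quad_profile theta alpha A B s x tau) ->
  (exists Tx0 Txs : R,
     is_derive_within (fun x => 0 <= x <= s t) (fun x => T x t) 0 Tx0 /\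
     is_derive_within (fun x => 0 <= x <= s t) (fun x => T x t) (s t) Txs /\
     RInt (fun x => RInt (fun z => Derive (fun tau => T z tau) t) 0 x) 0 (s t)
       = - (thermal_a k rho c) ^ 2 * (T 0 t + Tx0 * s t) /\
     k * Tx0 = h / sqrt t * (T 0 t - theta * Rpower t (alpha / 2)) /\
     T (s t) t = 0 /\
     k * Txs = - gamma * Rpower (s t) alpha * Derive s t)
  <-> profile_system k (thermal_a k rho c ^ 2) gamma theta h alpha A B
        t (s t) (Derive s t).
Proof.
intros th0 t0 spos ds ET.
pose proof (spos t t0) as st.
pose proof (sqrt_lt_R0 t t0) as rt.
set (a2 := thermal_a k rho c ^ 2).
pose proof (Rpower_pos t (alpha / 2)) as p0.
set (p := Rpower t (alpha / 2)) in *.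
assert (T0 : T 0 t = p * theta * (A + B)).
{ rewrite ET by lra; unfold quad_profile; fold p; field; lra. }
assert (Ts : T (s t) t = 0).
{ rewrite ET by lra; unfold quad_profile; fold p; field; lra. }
assert (D0 : is_derive_within (fun x => 0 <= x <= s t) (fun x => T x t) 0
               (- p * theta * (A + 2 * B) / s t)).
{ apply (is_derive_within_of_is_derive _
           (fun x => quad_profile theta alpha A B s x t)).
  - lra.
  - intros y Hy; symmetry; apply ET; assumption.
  - replace (A + 2 * B) with (A + 2 * B * (1 - 0 / s t)) by (field; lra).
    apply is_derive_quad_profile_space; assumption. }
assert (Ds : is_derive_within (fun x => 0 <= x <= s t) (fun x => T x t) (s t)
               (- p * theta * A / s t)).
{ apply (is_derive_within_of_is_derive _
           (fun x => quad_profile theta alpha A B s x t)).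
  - lra.
  - intros y Hy; symmetry; apply ET; assumption.
  - replace (- p * theta * A / s t)
      with (- p * theta * (A + 2 * B * (1 - s t / s t)) / s t) by (field; lra).
    apply is_derive_quad_profile_space; assumption. }
assert (EI : RInt (fun x => RInt (fun z => Derive (fun tau => T z tau) t) 0 x) 0 (s t)
             = theta * p * (alpha / (2 * t) * s t ^ 2 * (A / 3 + B / 4)
                            + s t * Derive s t * (A + B) / 6)).
{ rewrite (RInt_RInt_quadratic _ (s t)
             (theta * p * (alpha / (2 * t)) * (A + B))
             (theta * p * (A + 2 * B) / s t
                * (Derive s t / s t - alpha / (2 * t)))
             (theta * p * B / s t ^ 2
                * (alpha / (2 * t) - 2 * (Derive s t / s t))));
    [match goal with |- ?l = ?r => change (@eq R l r) end; field; lra|exact st|].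
  intros z Hz.
  transitivity (Derive (fun tau => quad_profile theta alpha A B s z tau) t).
  (* Since [z < s t], continuity of [s] keeps [z < s tau] for [tau] near [t], so the derivative sees
     only the profile. *)
  - apply Derive_ext_loc.
    generalize (filter_and _ _ (open_gt 0 t t0)
      (ex_derive_continuous s t ds _ (open_gt z (s t) (proj2 Hz)))).
    apply filter_imp; intros tau [tau0 Htau]; apply ET; lra.
  - erewrite is_derive_unique
      by (apply is_derive_quad_profile_time; assumption).
    fold p; field; lra. }
(* The points [d] and [s t - d] show that both ends of the interval are accumulation points of
   it. *)
assert (small : forall e : posreal, exists d, 0 < d < s t /\ d < e).
{ intros [e e0]; exists (Rmin e (s t) / 2); simpl.
  pose proof (Rmin_pos e (s t) e0 st); pose proof (Rmin_l e (s t)).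
  pose proof (Rmin_r e (s t)); lra. }
rewrite EI; unfold profile_system; fold p; fold a2.
split.
- intros (Tx0 & Txs & d0 & d1 & H1 & H2 & _ & H4).
  apply (is_derive_within_unique _ _ _ Tx0 (- p * theta * (A + 2 * B) / s t))
    in d0; [|intros e; destruct (small e) as (d & Hd & de); exists d|exact D0].
  2:{ rewrite Rminus_0_r, Rabs_pos_eq; lra. }
  apply (is_derive_within_unique _ _ _ Txs (- p * theta * A / s t))
    in d1; [|intros e; destruct (small e) as (d & Hd & de); exists (s t - d)|exact Ds].
  2:{ rewrite Rabs_minus_sym, Rabs_pos_eq; lra. }
  subst Tx0 Txs; rewrite T0 in H1, H2.
  repeat split.
  + apply (Rmult_eq_reg_l (theta * p)); [|apply Rgt_not_eq, Rmult_lt_0_compat; lra].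
    rewrite H1; fold a2; field; lra.
  + apply (Rmult_eq_reg_l (- (theta * p) / (s t * sqrt t))).
    * transitivity (k * (- p * theta * (A + 2 * B) / s t)); [field; lra|].
      rewrite H2; field; lra.
    * apply Rlt_not_eq; unfold Rdiv; rewrite Ropp_mult_distr_l_reverse.
      apply Ropp_lt_gt_0_contravar, Rdiv_lt_0_compat;
        apply Rmult_lt_0_compat; lra.
  + transitivity (- (k * (- p * theta * A / s t)) * s t); [field; lra|].
    rewrite H4; ring.
- intros (H1 & H2 & H4).
  exists (- p * theta * (A + 2 * B) / s t), (- p * theta * A / s t).
  refine (conj D0 (conj Ds (conj _ (conj _ (conj Ts _))))).
  + match goal with |- ?l = ?r => change (@eq R l r) end.
    rewrite H1, T0; fold a2; field; lra.
  + rewrite T0.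
    transitivity (- (theta * p) / (s t * sqrt t) * (k * (A + 2 * B) * sqrt t));
      [field; lra|].
    rewrite H2; field; lra.
  + transitivity (- (k * theta * p * A) / s t); [field; lra|].
    rewrite H4; field; lra.
Qed.

(** * Existence and uniqueness of the root of the equation for [nu] *)

Lemma denom3h_pos (alpha Bi nu : R) :
  0 <= alpha -> 0 < Bi -> 0 < nu -> 0 < denom3h alpha Bi nu.
Proof.
intros al0 Bi0 nu0; unfold denom3h.
pose proof (pow_lt nu 3 nu0); pose proof (pow_lt nu 2 nu0).
assert (0 <= alpha * nu ^ 3) by (apply Rmult_le_pos; lra).
assert (0 < 6 / Bi) by (apply Rdiv_lt_0_compat; lra).
assert (0 < (5 * alpha + 2) / Bi * nu ^ 2)
  by (apply Rmult_lt_0_compat; [apply Rdiv_lt_0_compat|]; lra).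
lra.
Qed.

Lemma denom3h_le (alpha Bi y z : R) :
  0 <= alpha -> 0 < Bi -> 0 < y <= z -> denom3h alpha Bi y <= denom3h alpha Bi z.
Proof.
intros al0 Bi0 yz; unfold denom3h.
assert (0 <= (5 * alpha + 2) / Bi) by (apply Rlt_le, Rdiv_lt_0_compat; lra).
assert (2 * alpha * y ^ 3 <= 2 * alpha * z ^ 3)
  by (apply Rmult_le_compat_l; [lra|apply pow_incr; lra]).
assert ((5 * alpha + 2) / Bi * y ^ 2 <= (5 * alpha + 2) / Bi * z ^ 2)
  by (apply Rmult_le_compat_l; [lra|apply pow_incr; lra]).
lra.
Qed.

(** The four terms with real exponents share the factor [Rpower 2 alpha * Rpower z alpha * z], and
    the cofactor is exactly the denominator of [A3h] and [B3h]. This form separates the increasing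
    side from the decreasing one. *)
Lemma nu3h_equation_factored (alpha Ste Bi z : R) :
  0 < Bi -> 0 < z ->
  nu3h_equation alpha Ste Bi z <->
  Rpower 2 alpha * Rpower z alpha * z * denom3h alpha Bi z
  = Ste * (6 - (2 + 3 * alpha) * z ^ 2).
Proof.
intros Bi0 z0; unfold nu3h_equation, denom3h.
assert (E : forall x, 0 < x -> Rpower x (alpha + 1) = Rpower x alpha * x
          /\ Rpower x (alpha + 2) = Rpower x alpha * x ^ 2
          /\ Rpower x (alpha + 3) = Rpower x alpha * x ^ 3
          /\ Rpower x (alpha + 4) = Rpower x alpha * x ^ 4).
{ intros x x0; rewrite !Rpower_plus, Rpower_1 by assumption.
  rewrite <- !Rpower_pow by assumption; simpl INR.
  repeat split; do 2 f_equal; ring. }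
destruct (E z z0) as (-> & -> & -> & ->).
destruct (E 2 Rlt_0_2) as (-> & -> & _ & _).
split; intros H.
- apply Rminus_diag_uniq; rewrite <- H; field; lra.
- apply Rminus_diag_eq in H; rewrite <- H; field; lra.
Qed.

Lemma nu3h_equation_unique (alpha Ste Bi y z : R) :
  0 <= alpha -> 0 < Ste -> 0 < Bi -> 0 < y -> 0 < z ->
  nu3h_equation alpha Ste Bi y -> nu3h_equation alpha Ste Bi z -> y = z.
Proof.
intros al0 Ste0 Bi0.
assert (aux : forall y z, 0 < y -> y < z ->
          nu3h_equation alpha Ste Bi y -> nu3h_equation alpha Ste Bi z -> False).
{ clear y z; intros y z y0 yz.
  rewrite !nu3h_equation_factored by lra; intros Ey Ez.
  assert (right : Ste * (6 - (2 + 3 * alpha) * z ^ 2)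
                  < Ste * (6 - (2 + 3 * alpha) * y ^ 2)).
  { apply Rmult_lt_compat_l; [lra|].
    apply Rplus_lt_compat_l, Ropp_lt_contravar.
    apply Rmult_lt_compat_l; [lra|].
    simpl; rewrite !Rmult_1_r; apply Rmult_le_0_lt_compat; lra. }
  assert (left : Rpower 2 alpha * Rpower y alpha * y * denom3h alpha Bi y
                 <= Rpower 2 alpha * Rpower z alpha * z * denom3h alpha Bi z).
  { pose proof (Rpower_pos 2 alpha); pose proof (Rpower_pos y alpha).
    pose proof (denom3h_pos alpha Bi y al0 Bi0 y0).
    apply Rmult_le_compat; [| lra | |apply denom3h_le; lra].
    - repeat apply Rmult_le_pos; lra.
    - apply Rmult_le_compat; [|lra| |lra].
      + apply Rmult_le_pos; lra.
      + apply Rmult_le_compat_l; [lra|apply Rle_Rpower_l; lra]. }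
  lra. }
intros y0 z0 Hy Hz.
destruct (Rtotal_order y z) as [l|[e|g]].
- destruct (aux y z y0 l Hy Hz).
- exact e.
- destruct (aux z y z0 g Hz Hy).
Qed.

(** Intermediate value theorem for the difference [F] of the two sides of the factored equation,
    between an explicit small [y] and 2. *)
Lemma nu3h_equation_exists (alpha Ste Bi : R) :
  0 <= alpha -> 0 < Ste -> 0 < Bi -> exists z, 0 < z /\ nu3h_equation alpha Ste Bi z.
Proof.
intros al0 Ste0 Bi0.
set (F := fun z => Rpower 2 alpha * Rpower z alpha * z * denom3h alpha Bi z
                   - Ste * (6 - (2 + 3 * alpha) * z ^ 2)).
pose proof (Rpower_pos 2 alpha) as u0.
pose proof (denom3h_pos alpha Bi 1 al0 Bi0 Rlt_0_1) as C0.
assert (uC0 := Rmult_lt_0_compat _ _ u0 C0).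
assert (K0 : 0 <= Ste * (2 + 3 * alpha)) by (apply Rmult_le_pos; lra).
set (K := Rpower 2 alpha * denom3h alpha Bi 1 + Ste * (2 + 3 * alpha)).
(* For [0 < y < 1], bounding [Rpower y alpha] by 1, [denom3h] by its value at 1 and [y ^ 2] by [y]
   gives [F y <= K * y - 6 * Ste]. This choice of [y] makes the bound equal to [- 6 * Ste * y]. *)
set (y := 6 * Ste / (K + 6 * Ste)).
assert (y0 : 0 < y) by (apply Rdiv_lt_0_compat; unfold K; lra).
assert (Ky : K * y + 6 * Ste * y = 6 * Ste) by (unfold y; field; unfold K; lra).
assert (y1 : y < 1).
{ apply (Rmult_lt_reg_l (K + 6 * Ste)); unfold K in *; nra. }
clearbody y.
assert (Fy : F y < 0).
{ assert (py : 0 < Rpower y alpha <= 1).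
  { split; [apply Rpower_pos|].
    replace 1 with (Rpower 1 alpha)
      by (unfold Rpower; rewrite ln_1, Rmult_0_r; apply exp_0).
    apply Rle_Rpower_l; lra. }
  assert (Rpower 2 alpha * Rpower y alpha * y * denom3h alpha Bi y
          <= Rpower 2 alpha * 1 * y * denom3h alpha Bi 1).
  { pose proof (denom3h_pos alpha Bi y al0 Bi0 y0).
    apply Rmult_le_compat; [| lra | |apply denom3h_le; lra].
    - repeat apply Rmult_le_pos; lra.
    - apply Rmult_le_compat_r; [lra|apply Rmult_le_compat_l; lra]. }
  assert (Ste * (2 + 3 * alpha) * y ^ 2 <= Ste * (2 + 3 * alpha) * y)
    by (apply Rmult_le_compat_l; [assumption|nra]).
  assert (0 < Ste * y) by (apply Rmult_lt_0_compat; lra).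
  unfold F, K in *; lra. }
(* At 2 the decreasing side, [Ste * (6 - 4 * (2 + 3 * alpha))], is already negative. *)
assert (F2 : 0 < F 2).
{ assert (0 < Rpower 2 alpha * Rpower 2 alpha * 2 * denom3h alpha Bi 2)
    by (pose proof (denom3h_pos alpha Bi 2 al0 Bi0 Rlt_0_2);
        repeat apply Rmult_lt_0_compat; lra).
  assert (0 <= Ste * alpha) by (apply Rmult_le_pos; lra).
  unfold F; lra. }
destruct (IVT_interv F y 2) as (z & Hz & Fz); try lra.
- intros x Hx; apply derivable_continuous_pt, ex_derive_Reals_0.
  unfold F, denom3h, Rpower; auto_derive; repeat split; lra.
- exists z; split; [lra|].
  apply nu3h_equation_factored; [lra|lra|]; unfold F in Fz; lra.
Qed.

(** * The time-independent system for a boundary proportional to [sqrt t] *)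

Lemma coefficients_iff (alpha Bi nu A B : R) :
  0 <= alpha -> 0 < Bi -> 0 < nu ->
  2 * alpha * nu ^ 2 * (A / 3 + B / 4) + nu ^ 2 * (A + B) / 3 = B /\
  A + 2 * B = 2 * Bi * nu * (1 - A - B)
  <-> A = A3h alpha Bi nu /\ B = B3h alpha Bi nu.
Proof.
intros al0 Bi0 nu0.
pose proof (denom3h_pos alpha Bi nu al0 Bi0 nu0) as D0.
set (e1 := B - (2 * alpha * nu ^ 2 * (A / 3 + B / 4) + nu ^ 2 * (A + B) / 3)).
set (e2 := A + 2 * B - 2 * Bi * nu * (1 - A - B)).
set (P := 1 - nu ^ 2 * (alpha / 2 + 1 / 3)).
set (Q := nu ^ 2 * (2 / 3 * alpha + 1 / 3)).
(* The two equations are [Q * A = P * B] and the Robin condition, and [denom3h]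
   is [6 / Bi] times the determinant [P + 2 * Q + 2 * Bi * nu * (P + Q)]. *)
assert (EA : A * denom3h alpha Bi nu - 12 * nu * P
             = 6 / Bi * (P * e2 - (2 + 2 * Bi * nu) * e1))
  by (unfold denom3h, e1, e2, P; field; lra).
assert (EB : B * denom3h alpha Bi nu - 12 * nu * Q
             = 6 / Bi * (Q * e2 + (1 + 2 * Bi * nu) * e1))
  by (unfold denom3h, e1, e2, Q; field; lra).
unfold A3h, B3h; fold P.
replace (12 * nu ^ 3 * (2 / 3 * alpha + 1 / 3)) with (12 * nu * Q)
  by (unfold Q; ring).
split.
- intros [E1 E2].
  replace e1 with 0 in * by (unfold e1; lra).
  replace e2 with 0 in * by (unfold e2; lra).
  split; apply (Rmult_eq_reg_r (denom3h alpha Bi nu)); try lra.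
  + transitivity (12 * nu * P); [lra|field; lra].
  + transitivity (12 * nu * Q); [lra|field; lra].
- intros [HA HB].
  assert (NA : A * denom3h alpha Bi nu = 12 * nu * P) by (rewrite HA; field; lra).
  assert (NB : B * denom3h alpha Bi nu = 12 * nu * Q) by (rewrite HB; field; lra).
  split; apply (Rmult_eq_reg_r (denom3h alpha Bi nu)); try lra.
  (* The integral condition has the form [(1 - P) * B + Q * A = B]; after multiplication by
     [denom3h], both [Q * A] and [P * B] become [12 * nu * P * Q]. *)
  + transitivity (B * denom3h alpha Bi nu * (1 - P)
                  + A * denom3h alpha Bi nu * Q); [unfold P, Q; field|].
    transitivity (B * denom3h alpha Bi nu * (1 - P) + 12 * nu * Q * P); [|].
    * rewrite NA; ring.
    * rewrite <- NB; ring.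
  + transitivity (A * denom3h alpha Bi nu + 2 * (B * denom3h alpha Bi nu));
      [ring|].
    transitivity (2 * Bi * nu * (denom3h alpha Bi nu - A * denom3h alpha Bi nu
                                 - B * denom3h alpha Bi nu)); [|ring].
    rewrite NA, NB; unfold denom3h, P, Q; field; lra.
Qed.

(** Here [st * dst] and [st ^ 2 / t] are constants, so the three relations are time-free ones
    multiplied by [a ^ 2], [k * sqrt t] and [gamma * Rpower a (alpha + 2) * Rpower t (alpha / 2)],
    all nonzero. The Biot and Stefan numbers appear written out. Because this is an equivalence at
    each single [t], one instant carries all the information. *)
Lemma profile_system_similarity
    (k a gamma theta h alpha A B nu t st dst : R) :
  0 < k -> 0 < a -> 0 < gamma -> 0 < nu -> 0 < t ->
  st = 2 * a * nu * sqrt t -> dst = a * nu / sqrt t ->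
  profile_system k (a ^ 2) gamma theta h alpha A B t st dst <->
  (2 * alpha * nu ^ 2 * (A / 3 + B / 4) + nu ^ 2 * (A + B) / 3 = B /\
   A + 2 * B = 2 * (a * h / k) * nu * (1 - A - B)) /\
  k * theta / (gamma * Rpower a (alpha + 2)) * A
  = 2 * Rpower 2 alpha * Rpower nu alpha * nu ^ 2.
Proof.
intros k0 a0 ga0 nu0 t0 Est Edst; unfold profile_system.
pose proof (sqrt_lt_R0 t t0) as rt.
assert (tt : t = sqrt t ^ 2) by (simpl; rewrite Rmult_1_r, sqrt_sqrt; lra).
(* The latent heat factor grows like [Rpower t (alpha / 2)], just as the profile does, so time
   cancels in the Stefan condition. *)
assert (Ep : Rpower st alpha
             = Rpower 2 alpha * Rpower a alpha * Rpower nu alpha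
               * Rpower t (alpha / 2)).
{ rewrite Est, <- !Rpower_mult_distr
    by (repeat apply Rmult_lt_0_compat; lra).
  f_equal; rewrite <- (Rpower_sqrt t t0), Rpower_mult; f_equal; field. }
replace (Rpower a (alpha + 2)) with (Rpower a alpha * a ^ 2)
  by (rewrite Rpower_plus, <- (Rpower_pow 2 a a0); simpl INR; do 2 f_equal; ring).
rewrite Ep.
pose proof (Rpower_pos t (alpha / 2)) as p0.
pose proof (Rpower_pos a alpha) as pa0.
set (p := Rpower t (alpha / 2)) in *; set (pa := Rpower a alpha) in *.
set (u := Rpower 2 alpha); set (v := Rpower nu alpha).
assert (Q1 : alpha / (2 * t) * st ^ 2 * (A / 3 + B / 4) + st * dst * (A + B) / 6
             = a ^ 2 * (2 * alpha * nu ^ 2 * (A / 3 + B / 4)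
                        + nu ^ 2 * (A + B) / 3)).
{ rewrite Est, Edst.
  replace (alpha / (2 * t)) with (alpha / (2 * sqrt t ^ 2))
    by (rewrite <- tt; reflexivity).
  field; lra. }
assert (Q2 : h * st * (1 - A - B)
             = k * sqrt t * (2 * (a * h / k) * nu * (1 - A - B)))
  by (rewrite Est; field; lra).
assert (Q4 : gamma * (u * pa * v * p) * dst * st
             = gamma * pa * a ^ 2 * p * (2 * u * v * nu ^ 2))
  by (rewrite Est, Edst; field; lra).
assert (Q5 : k * theta * p * A
             = gamma * pa * a ^ 2 * p * (k * theta / (gamma * (pa * a ^ 2)) * A))
  by (field; lra).
assert (a20 : a ^ 2 <> 0) by (apply pow_nonzero; lra).
assert (kt0 : k * sqrt t <> 0) by (apply Rgt_not_eq, Rmult_lt_0_compat; lra).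
assert (g0 : gamma * pa * a ^ 2 * p <> 0)
  by (apply Rgt_not_eq; repeat apply Rmult_lt_0_compat; lra).
rewrite Q1, Q2, Q4, Q5.
split.
- intros (H1 & H2 & H4); repeat split.
  + apply (Rmult_eq_reg_l _ _ _ H1 a20).
  + apply (Rmult_eq_reg_l (k * sqrt t)); [rewrite <- H2; ring|exact kt0].
  + apply (Rmult_eq_reg_l _ _ _ H4 g0).
- intros ([H1 H2] & H4); repeat split.
  + rewrite H1; reflexivity.
  + rewrite <- H2; ring.
  + rewrite H4; reflexivity.
Qed.

(** Once [A] is [A3h], both sides of the Stefan condition carry the nonzero factor
    [2 * nu / denom3h alpha Bi nu]; cancelling it leaves the factored equation. *)
Lemma similarity_system_iff (Ste Bi alpha nu A B : R) :
  0 <= alpha -> 0 < Bi -> 0 < nu ->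
  (2 * alpha * nu ^ 2 * (A / 3 + B / 4) + nu ^ 2 * (A + B) / 3 = B /\
   A + 2 * B = 2 * Bi * nu * (1 - A - B)) /\
  Ste * A = 2 * Rpower 2 alpha * Rpower nu alpha * nu ^ 2
  <-> (A = A3h alpha Bi nu /\ B = B3h alpha Bi nu)
      /\ nu3h_equation alpha Ste Bi nu.
Proof.
intros al0 Bi0 nu0.
rewrite coefficients_iff by assumption.
rewrite nu3h_equation_factored by assumption.
pose proof (denom3h_pos alpha Bi nu al0 Bi0 nu0) as D0.
assert (EA : Ste * A3h alpha Bi nu
             = 2 * nu / denom3h alpha Bi nu
               * (Ste * (6 - (2 + 3 * alpha) * nu ^ 2)))
  by (unfold A3h; field; lra).
assert (EL : 2 * Rpower 2 alpha * Rpower nu alpha * nu ^ 2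
             = 2 * nu / denom3h alpha Bi nu
               * (Rpower 2 alpha * Rpower nu alpha * nu * denom3h alpha Bi nu))
  by (field; lra).
assert (c0 : 2 * nu / denom3h alpha Bi nu <> 0)
  by (apply Rgt_not_eq, Rdiv_lt_0_compat; lra).
split; intros [[HA HB] H]; (split; [split; assumption|]); rewrite HA, EA, EL in *.
- symmetry; apply (Rmult_eq_reg_l _ _ _ H c0).
- rewrite H; reflexivity.
Qed.

(** * Admissibility of the explicit pair, and the main result *)

Lemma is_derive_s3h (a nu t : R) :
  0 < t -> is_derive (s3h a nu) t (a * nu / sqrt t).
Proof.
intros t0; pose proof (sqrt_lt_R0 t t0).
unfold s3h; auto_derive; [easy|field; lra].
Qed.

Lemma candidate_3h (theta alpha a Bi nu : R) :
  0 < a -> 0 < nu ->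
  candidate theta alpha (T3h theta alpha a Bi nu) (s3h a nu).
Proof.
intros a0 nu0.
assert (an0 : 0 < 2 * a * nu) by (repeat apply Rmult_lt_0_compat; lra).
repeat split.
- intros t _.
  (* [sqrt] is 0 on negative numbers, hence continuous on the whole line, and continuity at 0 within
     the half-line follows by restriction. *)
  apply (filterlim_filter_le_1 (F := locally t)).
  + exact (filter_le_within _).
  + exact (continuous_scal_r (2 * a * nu) sqrt t (continuous_sqrt t)).
- intros t _; apply Rmult_le_pos; [lra|apply sqrt_pos].
- intros t t0; apply Rmult_lt_0_compat; [lra|apply sqrt_lt_R0, t0].
- eexists; apply is_derive_s3h; assumption.
- apply (continuous_ext_loc _ (fun x => a * nu / sqrt x)).
  + generalize (open_gt 0 t H); apply filter_imp; intros x x0.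
    symmetry; apply is_derive_unique, is_derive_s3h, x0.
  + apply (@ex_derive_continuous R_AbsRing R_NormedModule).
    pose proof (sqrt_lt_R0 t H); auto_derive; repeat split; lra.
- exists (A3h alpha Bi nu), (B3h alpha Bi nu); intros t x _ _.
  unfold T3h, quad_profile; ring.
Qed.

(** Needed to solve the Robin condition for [st]. If the factor vanished, then [A = 2] and
    [B = - 1]; the Stefan condition with [A > 0] gives [st * dst > 0], so the left side of the
    integral condition is positive while the right side is [- c2]. *)
Lemma profile_system_Robin_factor
    (k c2 gamma theta h alpha A B t st dst : R) :
  0 < k -> 0 < c2 -> 0 < gamma -> 0 < theta -> 0 < h -> 0 <= alpha ->
  0 < t -> 0 < st ->
  profile_system k c2 gamma theta h alpha A B t st dst -> 1 - A - B <> 0.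
Proof.
intros k0 c0 ga0 th0 h0 al0 t0 st0 (H1 & H2 & H4) AB.
pose proof (sqrt_lt_R0 t t0) as rt.
assert (A2B : A + 2 * B = 0).
{ apply (Rmult_eq_reg_l (k * sqrt t)).
  - rewrite Rmult_0_r, <- (Rmult_0_r (h * st)), <- AB, <- H2; ring.
  - apply Rgt_not_eq, Rmult_lt_0_compat; lra. }
assert (EA : A = 2) by lra; assert (EB : B = - 1) by lra; subst A B.
pose proof (Rpower_pos t (alpha / 2)); pose proof (Rpower_pos st alpha).
assert (0 < k * theta * Rpower t (alpha / 2) * 2)
  by (repeat apply Rmult_lt_0_compat; lra).
assert (sd : 0 < st * dst).
{ apply (Rmult_lt_reg_l (gamma * Rpower st alpha)).
  - apply Rmult_lt_0_compat; lra.
  - lra. }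
assert (0 <= alpha / (2 * t) * st ^ 2).
{ apply Rmult_le_pos; [apply Rdiv_le_0_compat; lra|apply pow2_ge_0]. }
lra.
Qed.

Theorem theorem4p4 :
  forall k rho c gamma theta h alpha : R,
  0 < k -> 0 < rho -> 0 < c -> 0 < gamma -> 0 < theta -> 0 < h -> 0 <= alpha ->
  let a := thermal_a k rho c in
  let Ste := Ste_number k rho c gamma theta alpha in
  let Bi := Bi_number k rho c h in
  0 < Ste < 1 -> 0 < Bi ->
  exists nu : R,
    unique (fun z => 0 < z /\ nu3h_equation alpha Ste Bi z) nu /\
    problem_P3h k rho c gamma theta h alpha
      (T3h theta alpha a Bi nu) (s3h a nu) /\
    (forall (T : R -> R -> R) (s : R -> R),
       problem_P3h k rho c gamma theta h alpha T s ->
       same_pair T s (T3h theta alpha a Bi nu) (s3h a nu)).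
Proof.
intros k rho c gamma theta h alpha k0 rho0 c0 ga0 th0 h0 al0 a Ste Bi [Ste0 _] Bi0.
assert (a0 : 0 < a)
  by (apply sqrt_lt_R0, Rdiv_lt_0_compat; [|apply Rmult_lt_0_compat]; assumption).
destruct (nu3h_equation_exists alpha Ste Bi al0 Ste0 Bi0) as (nu & nu0 & Hnu).
exists nu; split; [|split].
- split; [split; assumption|].
  intros z [z0 Hz]; apply (nu3h_equation_unique alpha Ste Bi); assumption.
- pose proof (candidate_3h theta alpha a Bi nu a0 nu0) as C.
  split; [exact C|split].
  + intros t t0.
    destruct C as (_ & _ & spos & ds & _).
    apply (problem_iff_profile_system _ _ _ _ _ _ _
             (A3h alpha Bi nu) (B3h alpha Bi nu));
      try assumption; [apply ds, t0| |].
    * intros tau x _ _; unfold T3h, quad_profile; ring.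
    * apply (profile_system_similarity _ a _ _ _ _ _ _ nu); try assumption.
      -- reflexivity.
      -- apply is_derive_unique, is_derive_s3h, t0.
      -- apply (similarity_system_iff Ste Bi); auto.
  + unfold s3h; rewrite sqrt_0; ring.
- intros T s ((_ & _ & spos & ds & A & B & ET) & P & s0).
  assert (sys : forall t, 0 < t ->
            profile_system k (a ^ 2) gamma theta h alpha A B t (s t) (Derive s t)).
  { intros t t0; apply (problem_iff_profile_system k rho c _ _ _ _ _ _ T);
      try assumption; [apply ds, t0|apply P, t0]. }
  assert (AB : 1 - A - B <> 0).
  (* The coefficients do not depend on time, so any positive instant serves; 1 is taken. *)
  { apply (profile_system_Robin_factor k (a ^ 2) gamma theta h alpha A B
             1 (s 1) (Derive s 1)); try assumption.
    - apply pow_lt, a0.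
    - apply Rlt_0_1.
    - apply spos, Rlt_0_1.
    - apply sys, Rlt_0_1. }
  (* The Robin condition solved for [s t / sqrt t], then divided by [2 * a] to match [s3h]. *)
  set (mu := k * (A + 2 * B) / (h * (1 - A - B)) / (2 * a)).
  assert (Es : forall t, 0 < t -> s t = s3h a mu t).
  { intros t t0; destruct (sys t t0) as (_ & H2 & _).
    apply (Rmult_eq_reg_l (h * (1 - A - B))).
    - transitivity (h * s t * (1 - A - B)); [ring|].
      rewrite <- H2; unfold s3h, mu; field; lra.
    - apply Rmult_integral_contrapositive; split; lra. }
  assert (mu0 : 0 < mu).
  { pose proof (spos 1 Rlt_0_1) as H; rewrite (Es 1 Rlt_0_1) in H.
    unfold s3h in H; rewrite sqrt_1, Rmult_1_r in H.
    apply (Rmult_lt_reg_l (2 * a)); lra. }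
  assert (D1 : Derive s 1 = a * mu / sqrt 1).
  { rewrite (Derive_ext_loc s (s3h a mu)).
    - apply is_derive_unique, is_derive_s3h, Rlt_0_1.
    - exact (filter_imp _ _ Es (open_gt 0 1 Rlt_0_1)). }
  (* With [s] now known to be [s3h a mu], the system at time 1 alone identifies [A], [B] and makes
     [mu] a root of the equation. *)
  pose proof (sys 1 Rlt_0_1) as H.
  apply (profile_system_similarity k a gamma theta h alpha A B mu) in H;
    try assumption; [|apply Rlt_0_1|apply Es, Rlt_0_1].
  apply (similarity_system_iff Ste Bi) in H; try assumption.
  destruct H as [[EA EB] Hmu].
  assert (e : mu = nu)
    by (apply (nu3h_equation_unique alpha Ste Bi); assumption).
  clearbody mu; subst mu.
  split.
  + intros t [t0|<-]; [apply Es, t0|].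
    rewrite s0; unfold s3h; rewrite sqrt_0; ring.
  + intros t x t0 Hx; rewrite (ET t x t0 Hx).
    unfold quad_profile, T3h; rewrite (Es t t0), EA, EB; ring.
Qed.
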